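(* Let $\bm{a}\in\mathbb{R}^n$ and $b\in\mathbb{R}$ be given such that $\mathcal{C}=\{\bm{x}\in\mathbb{R}^n : \bm{a}^\top\bm{x}\le b,\ \bm{e}^\top\bm{x}=1,\ \bm{x}\ge 0\}$ is nonempty, and let $\bm{y}\in\mathbb{R}^n$. Let $\mathcal{K}_1=\{i\in\{1,\dots,n\} : (\Pi_{\mathcal{C}}(\bm{y}))_i=0\}$ and $\mathcal{K}_2=\{1,\dots,n\}\setminus\mathcal{K}_1$. Define $\bm{w},\bm{e}^n_{\mathcal{K}_2},\bm{a}^n_{\mathcal{K}_2}\in\mathbb{R}^n$ by $\bm{w}_i=(\bm{e}^n_{\mathcal{K}_2})_i=1$ and $(\bm{a}^n_{\mathcal{K}_2})_i=\bm{a}_i$ if $i\in\mathcal{K}_2$, and $\bm{w}_i=(\bm{e}^n_{\mathcal{K}_2})_i=(\bm{a}^n_{\mathcal{K}_2})_i=0$ otherwise. Then the element $\bm{N}_0$ (defined in the context) of the generalized HS-Jacobian of $\Pi_{\mathcal{C}}$ at $\bm{y}$ has the following explicit form. I. If $\bm{a}^\top\Pi_{\mathcal{C}}(\bm{y})\neq b$, then $$\bm{N}_0=\mathrm{Diag}(\bm{w})-\frac{1}{|\mathcal{K}_2|}\bm{e}^n_{\mathcal{K}_2}(\bm{e}^n_{\mathcal{K}_2})^\top .$$ II. If $\bm{a}^\top\Pi_{\mathcal{C}}(\bm{y})=b$, put $\eta:=\|\bm{a}_{\mathcal{K}_2}\|^2|\mathcal{K}_2|-(\bm{a}_{\mathcal{K}_2}^\top\bm{e}_{\mathcal{K}_2})^2$.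 (i) If $\eta\neq 0$, then $$\begin{aligned}\bm{N}_0=\ &\mathrm{Diag}(\bm{w})-\frac1\eta\Big(\sqrt{|\mathcal{K}_2|}\,\bm{a}^n_{\mathcal{K}_2}-\|\bm{a}_{\mathcal{K}_2}\|\bm{e}^n_{\mathcal{K}_2}\Big)\Big(\sqrt{|\mathcal{K}_2|}\,\bm{a}^n_{\mathcal{K}_2}-\|\bm{a}_{\mathcal{K}_2}\|\bm{e}^n_{\mathcal{K}_2}\Big)^\top\\ &-\frac{\sqrt{|\mathcal{K}_2|}\,\|\bm{a}_{\mathcal{K}_2}\|-\bm{a}_{\mathcal{K}_2}^\top\bm{e}_{\mathcal{K}_2}}{\eta}\Big(\bm{a}^n_{\mathcal{K}_2}(\bm{e}^n_{\mathcal{K}_2})^\top+\bm{e}^n_{\mathcal{K}_2}(\bm{a}^n_{\mathcal{K}_2})^\top\Big).\end{aligned}$$ (ii) If $\eta=0$, then $$\bm{N}_0=\mathrm{Diag}(\bm{w})-\frac{1}{\eta_1}\bm{u}\bm{u}^\top,\qquad \bm{u}:=\mathrm{sgn}(\bm{a}_{\mathcal{K}_2}^\top\bm{e}_{\mathcal{K}_2})\,\|\bm{a}_{\mathcal{K}_2}\|\,\bm{a}^n_{\mathcal{K}_2}+\sqrt{|\mathcal{K}_2|}\,\bm{e}^n_{\mathcal{K}_2},\qquad \eta_1:=(\|\bm{a}_{\mathcal{K}_2}\|^2+|\mathcal{K}_2|)^2 .$$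
   Context: Notation: $\bm{e}$ is the all-ones column vector; $\|\cdot\|$ is the Euclidean norm; $\Pi_{\mathcal{C}}(\bm{y})$ is the Euclidean projection of $\bm{y}$ onto the closed convex set $\mathcal{C}$; $\mathrm{Diag}(\bm{w})$ is the diagonal matrix with diagonal $\bm{w}$; $\bm{a}_{\mathcal{K}_2},\bm{e}_{\mathcal{K}_2}\in\mathbb{R}^{|\mathcal{K}_2|}$ are the subvectors of $\bm{a},\bm{e}$ indexed by $\mathcal{K}_2$; $\mathrm{sgn}(t)$ is $1$, $-1$, $0$ for $t>0$, $t<0$, $t=0$; $\dagger$ denotes the Moore-Penrose inverse; for a matrix $\bm{B}$ and a set $K$ of row indices, $\bm{B}_K$ is the submatrix formed by the rows of $\bm{B}$ in $K$, and $\bm{B}_i$ is the $i$-th row. Let $\bm{B}=\begin{bmatrix}-\bm{I}_n\\ \bm{a}^\top\end{bmatrix}\in\mathbb{R}^{(n+1)\times n}$ and $\bm{c}=\begin{bmatrix}\bm{0}\\ b\end{bmatrix}\in\mathbb{R}^{n+1}$, so that $\mathcal{C}=\{\bm{x}:\bm{e}^\top\bm{x}=1,\ \bm{B}\bm{x}\le\bm{c}\}$. The active index set is $\mathcal{I}(\bm{y})=\{i\in\{1,\dots,n+1\}:\bm{B}_i\Pi_{\mathcal{C}}(\bm{y})=\bm{c}_i\}$. The matrix $\bm{N}_0$ is $$\bm{N}_0:=\bm{I}_n-[\bm{B}_{\mathcal{I}(\bm{y})}^\top\ \ \bm{e}]\left(\begin{bmatrix}\bm{B}_{\mathcal{I}(\bm{y})}\\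 \bm{e}^\top\end{bmatrix}[\bm{B}_{\mathcal{I}(\bm{y})}^\top\ \ \bm{e}]\right)^{\dagger}\begin{bmatrix}\bm{B}_{\mathcal{I}(\bm{y})}\\ \bm{e}^\top\end{bmatrix}.$$ Background on the HS-Jacobian: let $\mathcal{M}(\bm{y})$ be the set of $(\lambda,\bm{\mu})\in\mathbb{R}\times\mathbb{R}^{n+1}$ with $\Pi_{\mathcal{C}}(\bm{y})-\bm{y}-\lambda\bm{e}+\bm{B}^\top\bm{\mu}=0$, $\bm{\mu}\ge0$, $\bm{\mu}^\top(\bm{B}\Pi_{\mathcal{C}}(\bm{y})-\bm{c})=0$. Let $\mathcal{K}_{\mathcal{C}}(\bm{y})$ be the collection of $K\subseteq\{1,\dots,n+1\}$ such that there is $(\lambda,\bm{\mu})\in\mathcal{M}(\bm{y})$ with $\mathrm{supp}(\bm{\mu})\subseteq K\subseteq\mathcal{I}(\bm{y})$ and $[\bm{B}_K^\top\ \bm{e}]$ has full column rank. The generalized HS-Jacobian of $\Pi_{\mathcal{C}}$ at $\bm{y}$ is the set $\mathcal{N}_{\mathcal{C}}(\bm{y})$ of all matrices $\bm{I}_n-[\bm{B}_K^\top\ \bm{e}]\left(\begin{bmatrix}\bm{B}_K\\ \bm{e}^\top\end{bmatrix}[\bm{B}_K^\top\ \bm{e}]\right)^{-1}\begin{bmatrix}\bm{B}_K\\ \bm{e}^\top\end{bmatrix}$ with $K\in\mathcal{K}_{\mathcal{C}}(\bm{y})$. It is a known fact that $\bm{N}_0\in\mathcal{N}_{\mathcal{C}}(\bm{y})$.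 *)

(* Defs.v *)
From HB Require Import structures.
From mathcomp Require Import all_boot all_order all_algebra.
From mathcomp Require Import boolp classical_sets reals.
Set Implicit Arguments.
Unset Strict Implicit.
Unset Printing Implicit Defensive.
Import Order.TTheory GRing.Theory Num.Theory.
Local Open Scope classical_set_scope.
Local Open Scope ring_scope.

(* Matrices carry the sup norm in MathComp-Analysis, hence a separate
   Euclidean norm. *)
Definition enorm (R : realType) (n : nat) (v : 'cV[R]_n) : R :=
  Num.sqrt (\sum_i v i 0 ^+ 2).

Definition dotv (R : realType) (n : nat) (u v : 'cV[R]_n) : R :=
  (u^T *m v) 0 0.

Definition ones (R : realType) (n : nat) : 'cV[R]_n := const_mx 1.

Definition subrows (R : realType) (m n : nat) (K : {set 'I_m})
    (A : 'M[R]_(m, n)) : 'M[R]_(#|K|, n) :=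
  rowsub (fun i : 'I_#|K| => enum_val i) A.

(* The default value is returned only if there is no nearest point, which
   cannot happen when C is nonempty, closed and convex. *)
Definition eproj (R : realType) (n : nat) (C : set 'cV[R]_n)
    (y : 'cV[R]_n) : 'cV[R]_n :=
  xget 0 [set p | C p /\ forall x, C x -> enorm (p - y) <= enorm (x - y)].

(* The four Penrose equations; they have exactly one solution X. *)
Definition is_mpinv (R : realType) (m n : nat) (A : 'M[R]_(m, n))
    (X : 'M[R]_(n, m)) : Prop :=
  [/\ A *m X *m A = A, X *m A *m X = X,
      (A *m X)^T = A *m X & (X *m A)^T = X *m A].

(* [pinvmx] is only some generalized inverse, not the Moore-Penrose one. *)
Definition mpinv (R : realType) (m n : nat) (A : 'M[R]_(m, n)) :
    'M[R]_(n, m) :=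
  xget 0 [set X | is_mpinv A X].

Section HSJacobian.
Variables (R : realType) (n : nat) (a : 'cV[R]_n) (b : R).

Definition feasible : set 'cV[R]_n :=
  [set x | [/\ dotv a x <= b, dotv (ones R n) x = 1 &
               forall i, 0 <= x i 0]].

(* [feasible] is {x | e^T x = 1, Bmx x <= cvec}: rows [lshift 1 i] encode
   x_i >= 0, row [rshift n 0] encodes a^T x <= b. *)
Definition Bmx : 'M[R]_(n + 1, n) := col_mx (- 1%:M) a^T.
Definition cvec : 'cV[R]_(n + 1) := col_mx 0 b%:M.

Definition active (y : 'cV[R]_n) : {set 'I_(n + 1)} :=
  [set i | (Bmx *m eproj feasible y) i 0 == cvec i 0]%SET.

Definition Erows (K : {set 'I_(n + 1)}) : 'M[R]_(#|K| + 1, n) :=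
  col_mx (subrows K Bmx) (ones R n)^T.
Definition Ecols (K : {set 'I_(n + 1)}) : 'M[R]_(n, #|K| + 1) :=
  row_mx (subrows K Bmx)^T (ones R n).

Definition multipliers (y : 'cV[R]_n) : set (R * 'cV[R]_(n + 1)) :=
  [set lm | [/\ eproj feasible y - y - lm.1 *: ones R n + Bmx^T *m lm.2 = 0,
                forall i, 0 <= lm.2 i 0 &
                dotv lm.2 (Bmx *m eproj feasible y - cvec) = 0]].

Definition supp (m : nat) (v : 'cV[R]_m) : {set 'I_m} :=
  [set i | v i 0 != 0]%SET.

Definition HS_index (y : 'cV[R]_n) : set {set 'I_(n + 1)} :=
  [set K : {set 'I_(n + 1)} | (exists2 lm, multipliers y lm &
              (supp lm.2 \subset K) && (K \subset active y)) /\
           \rank (Ecols K) = (#|K| + 1)%N].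

Definition HS_Jacobian (y : 'cV[R]_n) : set 'M[R]_n :=
  [set N | exists2 K, HS_index y K &
     N = 1%:M - Ecols K *m invmx (Erows K *m Ecols K) *m Erows K].

Definition N0 (y : 'cV[R]_n) : 'M[R]_n :=
  1%:M - Ecols (active y) *m mpinv (Erows (active y) *m Ecols (active y))
           *m Erows (active y).

End HSJacobian.

(* Main.v *)
Require Import Defs.
From HB Require Import structures.
From mathcomp Require Import all_boot all_order all_algebra.
From mathcomp Require Import boolp classical_sets reals.
From mathcomp Require Import topology normedtype derive.
From mathcomp Require Import ring lra.
Set Implicit Arguments.
Unset Strict Implicit.
Unset Printing Implicit Defensive.
Import Order.TTheory GRing.Theory Num.Theory.
Import numFieldNormedType.Exports.
Local Open Scope classical_set_scope.
Local Open Scope ring_scope.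

(* Let E have the gradients of the active constraints and the all-ones vector
   as columns. Whichever generalized inverse X of E^T E is used, 1 - E X E^T is
   the orthogonal projector onto ker E^T, the only symmetric matrix that maps
   into ker E^T and fixes it pointwise. Each explicit formula is checked against
   this characterization. For the membership in the HS-Jacobian, the variational
   inequality at the projection and a Farkas lemma yield multipliers whose
   support is linearly independent together with the all-ones vector; enlarging
   this support to a maximal independent set K of active constraints gives
   ker E_K^T = ker E^T, hence the same projector. *)

(** * Gram matrices, the Moore-Penrose inverse and orthogonal projectors *)

Lemma gram_eq0 (R : realDomainType) (m n : nat) (A : 'M[R]_(m, n)) :
  A^T *m A = 0 -> A = 0.
Proof.
move=> A0; apply/matrixP => i j; rewrite mxE.
move/matrixP/(_ j j): A0; rewrite !mxE => /eqP.
rewrite psumr_eq0 => [/allP/(_ i)|k _]; last by rewrite mxE -expr2 sqr_ge0.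
by rewrite mem_index_enum mxE -expr2 sqrf_eq0 => /(_ isT)/eqP.
Qed.

Lemma gram_unit (R : realFieldType) (m n : nat) (A : 'M[R]_(m, n)) :
  row_free A^T -> A^T *m A \in unitmx.
Proof.
move=> Afree; rewrite -row_free_unit; apply: inj_row_free => v vG0.
suff: A *m v^T = 0.
  move/(congr1 trmx); rewrite trmx_mul trmx0 trmxK => vA.
  by apply: (row_free_inj Afree); rewrite vA mul0mx.
apply: gram_eq0.
by rewrite trmx_mul trmxK -mulmxA (mulmxA A^T) mulmxA vG0 mul0mx.
Qed.

(** A full-rank factorization A = C D yields the solution D^T (D D^T)^-1 (C^T C)^-1 C^T of the
    Penrose equations, so [mpinv] never takes its default value. *)
Lemma mpinvP (R : realType) (m n : nat) (A : 'M[R]_(m, n)) :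
  is_mpinv A (mpinv A).
Proof.
suff [X AX] : exists X, is_mpinv A X.
  by rewrite /mpinv; case: xgetP => // /(_ X).
have [r [C [D [-> Cfree Dfree]]]] : exists r (C : 'M_(m, r)) (D : 'M_(r, n)),
    [/\ A = C *m D, row_free C^T & row_free D].
  exists (\rank A), (col_base A), (row_base A); split.
  - by rewrite mulmx_base.
  - by rewrite /row_free mxrank_tr; exact: col_base_full.
  - exact: row_base_free.
have Cu : C^T *m C \in unitmx by exact: gram_unit.
have Du : D *m D^T \in unitmx.
  by rewrite -{1}(trmxK D); apply: gram_unit; rewrite trmxK.
pose Ci := invmx (C^T *m C); pose Di := invmx (D *m D^T).
have CiT : Ci^T = Ci by rewrite trmx_inv trmx_mul trmxK.
have DiT : Di^T = Di by rewrite trmx_inv trmx_mul trmxK.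
have DDi : D *m (D^T *m Di) = 1%:M by rewrite mulmxA mulmxV.
have CiC : Ci *m C^T *m C = 1%:M by rewrite -mulmxA mulVmx.
exists (D^T *m Di *m (Ci *m C^T)).
have AX : C *m D *m (D^T *m Di *m (Ci *m C^T)) = C *m (Ci *m C^T).
  by rewrite -!mulmxA (mulmxA D) (mulmxA (D *m _)) -(mulmxA D) DDi mul1mx.
have XA : D^T *m Di *m (Ci *m C^T) *m (C *m D) = D^T *m Di *m D.
  by rewrite -!mulmxA (mulmxA C^T) (mulmxA Ci) (mulmxA Ci) CiC mul1mx.
split; rewrite ?AX ?XA.
- by rewrite -!mulmxA (mulmxA C^T) (mulmxA Ci) (mulmxA Ci) CiC mul1mx.
- by rewrite -!mulmxA (mulmxA D D^T) (mulmxA (D *m _)) mulmxV // mul1mx.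
- by rewrite !trmx_mul trmxK CiT mulmxA.
- by rewrite !trmx_mul trmxK DiT mulmxA.
Qed.

(** With M the left-hand side, the columns of M and of N lie in ker E^T, whence N M = M and M N = N.
    Both matrices are symmetric, so transposing the second identity gives N M = N. *)
Lemma gram_projector_unique (R : realDomainType) (m n : nat)
    (E : 'M[R]_(n, m)) (X : 'M[R]_m) (N : 'M[R]_n) :
  E^T *m E *m X *m (E^T *m E) = E^T *m E ->
  N^T = N -> (forall x : 'cV_n, E^T *m (N *m x) = 0) ->
  (forall x : 'cV_n, E^T *m x = 0 -> N *m x = x) ->
  1%:M - E *m X *m E^T = N.
Proof.
move=> GXG NT N_im N_id; set M := 1%:M - _.
have cancelE k (Y : 'M_(m, k)) : E^T *m E *m Y = 0 -> E *m Y = 0.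
  move=> EY; apply: gram_eq0.
  by rewrite trmx_mul -mulmxA (mulmxA E^T) EY mulmx0.
(* Stated for an arbitrary Y because it serves both for X and for X^T, which is again a generalized
   inverse of E^T E. *)
have XE (Y : 'M_m) : E^T *m E *m Y *m (E^T *m E) = E^T *m E ->
    E *m Y *m E^T *m E = E.
  move=> GYG; apply/eqP; rewrite -subr_eq0; apply/eqP.
  rewrite -!mulmxA -[X in _ - X]mulmx1 -mulmxBr; apply: cancelE.
  by rewrite mulmxBr mulmx1 !mulmxA -(mulmxA _ E^T E) GYG subrr.
have ME : M *m E = 0 by rewrite mulmxBl mul1mx XE ?subrr.
have MTE : M^T *m E = 0.
  rewrite linearB /= trmx1 mulmxBl mul1mx !trmx_mul trmxK mulmxA XE ?subrr //.
  by move/(congr1 trmx): GXG; rewrite !trmx_mul !trmxK !mulmxA.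
have EM : E^T *m M = 0 by rewrite -[E^T *m M]trmxK trmx_mul trmxK MTE trmx0.
have NM : N *m M = M.
  apply/matrixP => i j; have /colP/(_ i) : N *m col j M = col j M.
    by apply: N_id; rewrite colE mulmxA EM mul0mx.
  by rewrite !colE mulmxA -!colE !mxE.
have EN : E^T *m N = 0.
  apply/matrixP => i j; have /colP/(_ i) := N_im (delta_mx j 0).
  by rewrite mulmxA -colE !mxE.
have MN : M *m N = N by rewrite mulmxBl mul1mx -!mulmxA EN !mulmx0 subr0.
have : (M *m N)^T = N by rewrite MN NT.
(* Since M^T annihilates E, M^T M = M^T, and M^T M is symmetric. *)
have MT : M^T = M.
  have : M^T *m M = M^T.
    by rewrite {2}/M mulmxBr mulmx1 !mulmxA MTE !mul0mx subr0.
  by move=> MM; rewrite -[RHS]trmxK -MM trmx_mul trmxK.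
by rewrite trmx_mul NT MT NM.
Qed.

(** * Existence of the projection *)

Lemma dotvE (R : realType) (n : nat) (u v : 'cV[R]_n) :
  dotv u v = \sum_i u i 0 * v i 0.
Proof. by rewrite /dotv mxE; apply: eq_bigr => i _; rewrite mxE. Qed.

Lemma sum_continuous (R : realType) (T : topologicalType) (n : nat)
    (f : 'I_n -> T -> R) :
  (forall i, continuous (f i)) -> continuous (fun x => \sum_i f i x).
Proof.
move=> fc; elim: (index_enum _) => [|i s IHs].
  by under eq_fun do rewrite big_nil; move=> x; exact: cst_continuous.
under eq_fun do rewrite big_cons.
by move=> x; apply: continuousD; [exact: fc|exact: IHs].
Qed.

Section Projection.
Variables (R : realType) (n : nat) (a : 'cV[R]_n) (b : R).

Lemma coord_tr_continuous (i : 'I_n) :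
  continuous (fun x : 'rV[R]_n => x^T i 0).
Proof. by under eq_fun do rewrite mxE; exact: coord_continuous. Qed.

Lemma dotv_tr_continuous (u : 'cV[R]_n) :
  continuous (fun x : 'rV[R]_n => dotv u x^T).
Proof.
under eq_fun do rewrite dotvE; apply: sum_continuous => i x.
apply: continuousM; first exact: cst_continuous.
exact: coord_tr_continuous.
Qed.

(** Nonnegative coordinates of sum 1 lie in [0, 1], so the set is closed in a cube. Row vectors are
    used to match [rV_compact] and [EVT_min_rV]. *)
Lemma feasible_tr_compact : compact [set x : 'rV[R]_n | feasible a b x^T].
Proof.
apply: (@subclosed_compact _ _
  [set x : 'rV[R]_n | forall i, `[0, 1]%classic (x ord0 i)]).
- have -> : [set x : 'rV[R]_n | feasible a b x^T] =
      (fun x => dotv a x^T) @^-1` [set t | t <= b] `&`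
      (fun x => dotv (ones R n) x^T) @^-1` [set 1] `&`
      \bigcap_i (fun x => x 0 i) @^-1` [set t | 0 <= t].
    apply/seteqP; split => x /=.
      by case=> ? ? x0; split => // i _ /=; have := x0 i; rewrite mxE.
    by case=> -[? ?] x0; split => // i; rewrite mxE; exact: x0.
  apply: closedI; first apply: closedI.
  + apply: closed_comp => [x _|]; last exact: closed_le.
    exact: dotv_tr_continuous.
  + apply: closed_comp => [x _|]; last exact: closed_eq.
    exact: dotv_tr_continuous.
  + apply: closed_bigI => i _; apply: closed_comp => [x _|].
      exact: coord_continuous.
    exact: closed_ge.
- have := @rV_compact R n (fun=> `[0, 1]%classic); apply=> i.
  exact: segment_compact.
- move=> x [_]; rewrite dotvE => x1 x0 i /=; rewrite in_itv /=.
  have := x0 i; rewrite mxE => -> /=; rewrite -x1 (bigD1 i) //= !mxE mul1r.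
  by rewrite lerDl sumr_ge0 // => j _; rewrite mulr_ge0 // mxE ler01.
Qed.

(** The squared distance attains its minimum on the compact feasible set, so [eproj] does not return
    its default value. *)
Lemma eproj_feasible (y : 'cV[R]_n) : feasible a b !=set0 ->
  let p := eproj (feasible a b) y in
  feasible a b p /\
  forall x, feasible a b x -> dotv (p - y) (p - y) <= dotv (x - y) (x - y).
Proof.
move=> [x0 Cx0] /=.
have enorm_le (u v : 'cV[R]_n) : (enorm u <= enorm v) = (dotv u u <= dotv v v).
  rewrite /enorm ler_sqrt; last by apply: sumr_ge0 => i _; exact: sqr_ge0.
  by rewrite !dotvE; under eq_bigr do rewrite expr2;
     under [leRHS]eq_bigr do rewrite expr2.
pose f (x : 'rV[R]_n) := dotv (x^T - y) (x^T - y).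
have [||c /set_mem Cc cmin] :=
  @EVT_min_rV R n f [set x | feasible a b x^T] _ feasible_tr_compact.
- by exists x0^T => /=; rewrite trmxK.
- apply: continuous_subspaceT; rewrite /f; under eq_fun do rewrite dotvE.
  apply: sum_continuous => i.
  suff cf : continuous (fun x : 'rV[R]_n => (x^T - y) i 0).
    by move=> x; apply: continuousM; exact: cf.
  have -> : (fun x : 'rV[R]_n => (x^T - y) i 0) = (fun x => x^T i 0 - y i 0).
    by apply/funext => x; rewrite !mxE.
  move=> x; apply: continuousB; last exact: cst_continuous.
  exact: coord_tr_continuous.
rewrite /eproj; case: xgetP => [p _ [Cp pmin]|/(_ c^T)[]].
  by split=> // x Cx; rewrite -enorm_le; exact: pmin.
split=> // x Cx; rewrite enorm_le; have := cmin x^T; rewrite /f trmxK; apply.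
by apply/mem_set; rewrite /= trmxK.
Qed.
End Projection.

(** * Bilinearity and positivity of the inner product *)

Section Dotv.
Variables (R : realType) (n : nat).
Implicit Types u v w : 'cV[R]_n.

Lemma dotvC u v : dotv u v = dotv v u.
Proof. by rewrite !dotvE; apply: eq_bigr => i _; rewrite mulrC. Qed.

Lemma dotvDl u v w : dotv (u + v) w = dotv u w + dotv v w.
Proof. by rewrite /dotv linearD mulmxDl mxE. Qed.

Lemma dotvZl (c : R) u w : dotv (c *: u) w = c * dotv u w.
Proof. by rewrite /dotv linearZ /= -scalemxAl mxE. Qed.

Lemma dotvBl u v w : dotv (u - v) w = dotv u w - dotv v w.
Proof. by rewrite -scaleN1r dotvDl dotvZl mulN1r. Qed.

Lemma dotvDr u v w : dotv u (v + w) = dotv u v + dotv u w.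
Proof. by rewrite !(dotvC u) dotvDl. Qed.

Lemma dotvZr (c : R) u v : dotv u (c *: v) = c * dotv u v.
Proof. by rewrite !(dotvC u) dotvZl. Qed.

Lemma dotvBr u v w : dotv u (v - w) = dotv u v - dotv u w.
Proof. by rewrite !(dotvC u) dotvBl. Qed.

Lemma dotv_suml (I : finType) (P : pred I) (F : I -> 'cV[R]_n) w :
  dotv (\sum_(i | P i) F i) w = \sum_(i | P i) dotv (F i) w.
Proof. by rewrite /dotv raddf_sum mulmx_suml summxE. Qed.

Lemma dotv0l w : dotv 0 w = 0.
Proof. by rewrite /dotv trmx0 mul0mx mxE. Qed.

Lemma dotv_eq0 u : (dotv u u == 0) = (u == 0).
Proof.
apply/eqP/eqP => [uu|->]; last exact: dotv0l.
by apply: gram_eq0; apply/matrixP => i j; rewrite !ord1 [RHS]mxE.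
Qed.

Lemma dotv_ge0 u : 0 <= dotv u u.
Proof. by rewrite dotvE; apply: sumr_ge0 => i _; rewrite -expr2 sqr_ge0. Qed.

End Dotv.

(** * A Farkas lemma with independent support *)

Section Farkas.
Variables (R : realType) (n : nat) (T : finType) (e : 'cV[R]_n).
Hypothesis e0 : e != 0.

(** Linear independence of the family together with [e]: as [e] is nonzero, [l] vanishes as soon as
    all the [c i] do. *)
Definition indep (f : T -> 'cV[R]_n) (K : {set T}) : Prop :=
  forall (l : R) (c : T -> R), l *: e + \sum_(i in K) c i *: f i = 0 ->
    forall i, i \in K -> c i = 0.

(* Bartl's induction: if dropping the constraint [j] breaks the implication,
   witnessed by [x0], eliminate [f j] along [x0] from [g] and from the other
   constraints; the support found for the reduced system stays independent
   when [j] is added. *)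
Lemma farkas_indep (s : seq T) (f : T -> 'cV[R]_n) (g : 'cV[R]_n) : uniq s ->
  (forall x, dotv e x = 0 -> (forall i, i \in s -> dotv (f i) x <= 0) ->
     dotv g x <= 0) ->
  exists (K : {set T}) (l : R) (mu : T -> R),
    [/\ {subset K <= s}, indep f K, forall i, 0 <= mu i &
        g = l *: e + \sum_(i in K) mu i *: f i].
Proof.
elim: s f g => [|j s IHs] f g /=.
  (* The residual of the orthogonal projection of [g] onto the line of [e] is itself a test vector
     for [gle0], which bounds its squared norm by 0. *)
  move=> _ gle0; exists finset.set0, (dotv g e / dotv e e), (fun=> 0).
  split=> //; [by move=> i; rewrite inE|by move=> l c _ i; rewrite inE|].
  rewrite big_set0 addr0; set l := _ / _.
  apply/eqP; rewrite -subr_eq0 -dotv_eq0.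
  have ex0 : dotv e (g - l *: e) = 0.
    by rewrite dotvBr dotvZr /l divfK ?dotv_eq0 // dotvC subrr.
  rewrite eq_le dotv_ge0 andbT dotvBl dotvZl ex0 mulr0 subr0.
  by apply: gle0 => // i.
case/andP => js us gle0.
have [gle0'|] := pselect (forall x, dotv e x = 0 ->
    (forall i, i \in s -> dotv (f i) x <= 0) -> dotv g x <= 0).
  have [K [l [mu [Ks Kf mu0 ->]]]] := IHs f g us gle0'.
  by exists K, l, mu; split=> // i /Ks iS; rewrite inE iS orbT.
case/existsNP => x0 /not_implyP[ex0] /not_implyP[fx0 /negP].
rewrite -ltNge => gx0.
have tgt0 : 0 < dotv (f j) x0.
  rewrite ltNge; apply/negP => fj0; suff : dotv g x0 <= 0 by rewrite leNgt gx0.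
  by apply: gle0 => // i; rewrite inE => /predU1P[->|/fx0].
set t := dotv (f j) x0 in tgt0; have t0 := lt0r_neq0 tgt0.
pose c i := dotv (f i) x0 / t.
have [|K [l [mu [Ks Kf mu0 gE]]]] :=
    IHs (fun i => f i - c i *: f j) (g - (dotv g x0 / t) *: f j) us.
  move=> x ex fx; set z := dotv (f j) x.
  (* Testing the reduced vectors on x amounts to testing the original ones on x - (z / t) x0, which
     is orthogonal to [f j]. *)
  have -> : dotv (g - (dotv g x0 / t) *: f j) x = dotv g (x - (z / t) *: x0).
    by rewrite dotvBl dotvZl dotvBr dotvZr -/z; field.
  apply: gle0; first by rewrite dotvBr dotvZr ex ex0 mulr0 subr0.
  move=> i; rewrite inE dotvBr dotvZr => /predU1P[->|/fx].
    by rewrite -/z -/t divfK ?subrr.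
  by rewrite dotvBl dotvZl -/z /c; congr (_ <= _); field.
have jK : j \notin K by apply: contra js => /Ks.
have Kj i : i \in K -> (i == j) = false.
  by move=> iK; apply: contraNF jK => /eqP <-.
have sumK (d : T -> R) : \sum_(i in K) d i *: (f i - c i *: f j) =
    \sum_(i in K) d i *: f i - (\sum_(i in K) d i * c i) *: f j.
  rewrite scaler_suml -sumrB; apply: eq_bigr => i _.
  by rewrite scalerBr scalerA.
(* The coefficient of [f j] after the elimination is undone. It is nonnegative because [x0]
   satisfies every constraint of [s], so that [c i <= 0] on K. *)
pose mu' i := if i == j then dotv g x0 / t - \sum_(i in K) mu i * c i else mu i.
exists (j |: K), l, mu'; split.
- by move=> i; rewrite !inE => /orP[->//|/Ks ->]; rewrite orbT.
- move=> l' d; rewrite big_setU1 //= => dE.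
  (* Pairing the relation with [x0] removes [e] and determines [d j]; substituting it leaves a
     relation between the reduced vectors. *)
  have dj : d j = - \sum_(i in K) d i * c i.
    move: (congr1 (fun v => dotv v x0) dE).
    rewrite !dotvDl dotv0l !dotvZl ex0 mulr0 add0r dotv_suml -/t => dt.
    apply: (mulIf t0); rewrite mulNr mulr_suml; apply/eqP.
    rewrite -addr_eq0 -[X in _ == X]dt; apply/eqP; congr (_ + _).
    apply: eq_bigr => i _.
    by rewrite dotvZl /c mulrA divfK.
  have dK : forall i, i \in K -> d i = 0.
    apply: (Kf l' d); rewrite sumK -scaleNr -dj -[RHS]dE.
    by congr (_ + _); rewrite addrC.
  move=> i; rewrite !inE => /predU1P[->|]; last exact: dK.
  by rewrite dj big1 ?oppr0 // => k kK; rewrite dK ?mul0r.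
- move=> i; rewrite /mu'; case: eqP => _ //.
  apply: addr_ge0; first by rewrite divr_ge0 // ltW.
  rewrite oppr_ge0.
  apply: sumr_le0 => k kK; rewrite mulr_ge0_le0 // /c.
  by rewrite pmulr_lle0 ?invr_gt0 // fx0 // Ks.
- rewrite big_setU1 //= {1}/mu' eqxx.
  rewrite [X in _ + (_ + X)](eq_bigr (fun i => mu i *: f i)); last first.
    by move=> i iK; rewrite /mu' Kj.
  rewrite sumK in gE.
  rewrite -[LHS](subrK ((dotv g x0 / t) *: f j)) gE scalerBl.
  by rewrite -!addrA; congr (_ + _); rewrite addrC -addrA addrCA.
Qed.

(** Take a maximal independent set between K and J. Any further index of J creates a dependence,
    which expresses its vector through [e] and the chosen ones. *)
Lemma indep_extend (f : T -> 'cV[R]_n) (K J : {set T}) :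
  indep f K -> K \subset J ->
  exists K' : {set T}, [/\ K \subset K', K' \subset J, indep f K' &
    forall x, dotv e x = 0 -> (forall i, i \in K' -> dotv (f i) x = 0) ->
      forall i, i \in J -> dotv (f i) x = 0].
Proof.
move=> Kf KJ; pose P (L : {set T}) := (L \subset J) && `[< indep f L >].
have PK : P K by rewrite /P KJ; apply/asboolP.
have [L /maxsetP[/andP[LJ /asboolP Lf] Lmax] KL] := maxset_exists PK.
exists L; split=> // x ex fx i iJ.
have [/fx//|iL] := boolP (i \in L).
have : ~ indep f (i |: L).
  move=> iLf; have : i |: L = L.
    apply: Lmax; last exact: finset.subsetUr.
    by rewrite /P finset.subUset finset.sub1set iJ LJ; apply/asboolP.
  by move/setP/(_ i); rewrite !inE eqxx (negPf iL).
case/existsNP => l /existsNP[c] /not_implyP[]; rewrite big_setU1 //= => cE.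
case/existsNP => j /not_implyP[jL cj].
(* Otherwise the dependence would live on L alone and be trivial. *)
have ci : c i != 0.
  apply/eqP => ci; apply: cj; move: jL; rewrite !inE => /predU1P[->//|].
  by apply: (Lf l c); rewrite -[RHS]cE ci scale0r add0r.
move/(congr1 (fun v => dotv v x)): cE.
rewrite !dotvDl dotv0l !dotvZl ex mulr0 add0r dotv_suml big1 ?addr0 => [|k kL].
  by move/eqP; rewrite mulf_eq0 (negPf ci) => /eqP.
by rewrite dotvZl fx ?mulr0.
Qed.

End Farkas.

(** The ratio test: only indices with [h i > 0] restrict the step, and there [g i > 0]. The cap 1
    covers the case where no index restricts it. *)
Lemma small_step (R : realFieldType) (I : finType) (g h : I -> R) :
  (forall i, 0 <= g i) -> (forall i, g i = 0 -> h i <= 0) ->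
  exists2 t0 : R, 0 < t0 & forall t, 0 <= t <= t0 -> forall i, t * h i <= g i.
Proof.
move=> g0 gh; exists (\big[Num.min/1]_(i | 0 < h i) (g i / h i)).
  apply: lt_bigmin => // i hi; rewrite divr_gt0 // lt_neqAle g0 andbT eq_sym.
  by apply: contraL hi => /eqP/gh; rewrite -leNgt.
move=> t /andP[t0 tle] i; have [hi|hi] := ltP 0 (h i).
  rewrite -ler_pdivlMr //; apply: le_trans tle _.
  exact: (@bigmin_le_cond _ _ _ _ i (fun i => 0 < h i) (fun i => g i / h i)).
by apply: le_trans (g0 i); exact: mulr_ge0_le0.
Qed.

(** * Constraint rows and the variational inequality at the projection *)

Section KKT.
Variables (R : realType) (n : nat) (a : 'cV[R]_n) (b : R).
Notation B := (Bmx a).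
Notation c := (cvec n b).

Lemma Bmx_lshift (x : 'cV[R]_n) (i : 'I_n) : (B *m x) (lshift 1 i) 0 = - x i 0.
Proof. by rewrite mul_col_mx col_mxEu mulNmx mul1mx mxE. Qed.

Lemma Bmx_rshift (x : 'cV[R]_n) (i : 'I_1) : (B *m x) (rshift n i) 0 = dotv a x.
Proof. by rewrite mul_col_mx col_mxEd ord1. Qed.

Lemma cvec_lshift (i : 'I_n) : c (lshift 1 i) 0 = 0.
Proof. by rewrite col_mxEu mxE. Qed.

Lemma cvec_rshift (i : 'I_1) : c (rshift n i) 0 = b.
Proof. by rewrite col_mxEd ord1 mxE eqxx. Qed.

Lemma feasibleP (x : 'cV[R]_n) :
  feasible a b x <->
  dotv (ones R n) x = 1 /\ forall i, (B *m x) i 0 <= c i 0.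
Proof.
split=> [[ax ex x0]|[ex Bx]].
  split=> // i; case: (split_ordP i) => j ->.
    by rewrite Bmx_lshift cvec_lshift oppr_le0.
  by rewrite Bmx_rshift cvec_rshift.
split=> //; first by have := Bx (rshift n 0); rewrite Bmx_rshift cvec_rshift.
by move=> i; have := Bx (lshift 1 i); rewrite Bmx_lshift cvec_lshift oppr_le0.
Qed.

Lemma dotv_row (i : 'I_(n + 1)) (x : 'cV[R]_n) :
  dotv (row i B)^T x = (B *m x) i 0.
Proof. by rewrite /dotv trmxK -row_mul mxE. Qed.

Lemma tr_Erows (K : {set 'I_(n + 1)}) : (Erows a K)^T = Ecols a K.
Proof. by rewrite tr_col_mx trmxK. Qed.

Lemma tr_Ecols (K : {set 'I_(n + 1)}) : (Ecols a K)^T = Erows a K.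
Proof. by rewrite -tr_Erows trmxK. Qed.

Lemma Erows_eq0 (K : {set 'I_(n + 1)}) (x : 'cV[R]_n) :
  Erows a K *m x = 0 <->
  (forall i, i \in K -> (B *m x) i 0 = 0) /\ dotv (ones R n) x = 0.
Proof.
rewrite mul_col_mx /subrows mul_rowsub_mx; split=> [/eqP|[Bx ex]].
  rewrite col_mx_eq0 => /andP[/eqP Bx /eqP ex].
  split=> [i iK|]; last by rewrite /dotv ex mxE.
  have /colP/(_ (enum_rank_in iK i)) := Bx.
  by rewrite mxE enum_rankK_in // !mxE.
apply/eqP; rewrite col_mx_eq0; apply/andP; split; apply/eqP/colP => i.
  by rewrite mxE Bx ?enum_valP // mxE.
by rewrite ord1 [RHS]mxE -ex.
Qed.

Lemma indep_row_free (K : {set 'I_(n + 1)}) :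
  ones R n != 0 -> indep (ones R n) (fun i => (row i B)^T) K ->
  row_free (Erows a K).
Proof.
move=> e0 Kf; apply: inj_row_free => v; rewrite -(hsubmxK v) mul_row_col.
set v1 := lsubmx v; set v2 := rsubmx v => vE.
(* Turns coefficients indexed by positions in the enumeration of K into coefficients indexed by
   constraints; each sum over K has a single term. *)
pose d i := \sum_(j < #|K| | enum_val j == i) v1 0 j.
have dE j : d (enum_val j) = v1 0 j.
  by rewrite /d (big_pred1 j) // => k; rewrite /= (inj_eq enum_val_inj).
have d0 : forall i, i \in K -> d i = 0.
  apply: (Kf (v2 0 0)); apply: trmx_inj; rewrite trmx0 -vE linearD /= addrC.
  congr (_ + _).
    rewrite big_enum_val linear_sum mulmx_sum_row; apply: eq_bigr => j _ /=.
    by rewrite dE linearZ /= trmxK row_rowsub.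
  by rewrite linearZ /= [v2]mx11_scalar mul_scalar_mx mxE.
have v10 : v1 = 0 by apply/rowP => j; rewrite -dE d0 ?enum_valP // mxE.
have v20 : v2 = 0.
  apply/eqP; apply: contraNT e0; rewrite [v2]mx11_scalar => v20.
  move: vE; rewrite v10 mul0mx add0r [v2]mx11_scalar mul_scalar_mx => /eqP.
  rewrite scaler_eq0 => /orP[/eqP v2E|].
    by rewrite v2E raddf0 eqxx in v20.
  by rewrite -(inj_eq trmx_inj) trmx0.
by rewrite v10 v20 row_mx0.
Qed.

Hypothesis C0 : feasible a b !=set0.

Lemma ones_neq0 : ones R n != 0.
Proof.
have [x [_ ex _]] := C0; apply/eqP => e0.
by move: ex; rewrite e0 dotv0l => /esym/eqP; rewrite oner_eq0.
Qed.

Variable y : 'cV[R]_n.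
Let p := eproj (feasible a b) y.

(** Inactive constraints have slack, so p + t d is feasible for small t > 0, and it cannot be closer
    to y than p. *)
Lemma eproj_variational (d : 'cV[R]_n) : dotv (ones R n) d = 0 ->
  (forall i, i \in active a b y -> (B *m d) i 0 <= 0) -> dotv (y - p) d <= 0.
Proof.
move=> ed Bd; have [Cp pmin] := eproj_feasible y C0; rewrite -/p in Cp pmin.
have [ep Bp] := (feasibleP _).1 Cp.
have [||t0 t0gt0 step] := @small_step _ _ (fun i => c i 0 - (B *m p) i 0)
    (fun i => (B *m d) i 0).
- by move=> i; rewrite subr_ge0.
- by move=> i /eqP; rewrite subr_eq0 eq_sym => ip; apply: Bd; rewrite inE.
rewrite leNgt; apply/negP; set q := dotv _ _ => q0.
set D := dotv d d; have D0 : 0 <= D by exact: dotv_ge0.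
(* Minimality gives 2 q <= t D, whereas this t satisfies t D < q; the summand 1 keeps the
   denominator positive. *)
pose t := Num.min t0 (q / (D + 1)).
have tgt0 : 0 < t by rewrite lt_min t0gt0 divr_gt0 // ltr_wpDl.
have tq : t * (D + 1) <= q.
  by rewrite -ler_pdivlMr ?ltr_wpDl // /t ge_min lexx orbT.
have /pmin : feasible a b (p + t *: d).
  apply/feasibleP; rewrite dotvDr dotvZr ed mulr0 addr0; split=> // i.
  have := step t; rewrite ltW //= /t ge_min lexx -/t => /(_ isT i).
  by rewrite mulmxDr -scalemxAr [X in X <= _ -> _]mulrC lerBrDl !mxE mulrC.
have -> : p + t *: d - y = t *: d - (y - p) by rewrite opprB addrCA addrA.
have -> : p - y = (-1) *: (y - p) by rewrite scaleN1r opprB.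
rewrite !(dotvBl (t *: d)) !(dotvBr _ (t *: d)) !dotvZl !dotvZr (dotvC d).
rewrite -/q -/D.
by nra.
Qed.
End KKT.

(** * The HS-Jacobian and the explicit form of the projector *)

Section HS.
Variables (R : realType) (n : nat) (a : 'cV[R]_n) (b : R).
Variable y : 'cV[R]_n.
Notation B := (Bmx a).
Notation p := (eproj (feasible a b) y).

Lemma HS_index_active : feasible a b !=set0 ->
  exists2 K, HS_index a b y K &
    forall x : 'cV_n, Erows a K *m x = 0 <-> Erows a (active a b y) *m x = 0.
Proof.
move=> C0; have e0 := ones_neq0 C0.
have [|K0 [l [mu [K0I K0f mu0 gE]]]] := farkas_indep e0
    (f := fun i => (row i B)^T) (g := y - p) (enum_uniq (active a b y)).
  move=> x ex Bx; apply: eproj_variational => // i iI.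
  by rewrite -dotv_row; apply: Bx; rewrite mem_enum.
have {}K0I : K0 \subset active a b y.
  by apply/fintype.subsetP => i /K0I; rewrite mem_enum.
have [K [K0K KI Kf Kspan]] := indep_extend K0f K0I.
exists K; last first.
  move=> x; rewrite !Erows_eq0; split=> -[Bx ex]; split=> // i iK.
    by rewrite -dotv_row; apply: Kspan => // j jK; rewrite dotv_row; exact: Bx.
  by apply: Bx; exact: (fintype.subsetP KI).
split; last by rewrite -tr_Erows mxrank_tr; apply/eqP; exact: indep_row_free.
pose m : 'cV[R]_(n + 1) := \col_i (if i \in K0 then mu i else 0).
(* The sign is reversed because the stationarity equation subtracts the multiple of the all-ones
   vector, while [gE] adds it. *)
exists (- l, m); last first.
  rewrite KI andbT; apply: fintype.subset_trans K0K; apply/fintype.subsetP => i.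
  by rewrite inE mxE; case: ifP; rewrite ?eqxx.
split=> /=.
- have -> : B^T *m m = \sum_(i in K0) mu i *: (row i B)^T.
    apply: trmx_inj; rewrite trmx_mul trmxK mulmx_sum_row linear_sum.
    rewrite [RHS]big_mkcond; apply: eq_bigr => i _; rewrite !mxE /=.
    by case: ifP => _; rewrite ?scale0r ?linearZ //= trmxK.
  by rewrite scaleNr opprK -addrA -gE addrC subrKA subrr.
- by move=> i; rewrite mxE; case: ifP.
- rewrite dotvE big1 // => i _; rewrite mxE.
  case: ifP => [/(fintype.subsetP K0I)|_]; last by rewrite mul0r.
  rewrite inE => /eqP Bp.
  by rewrite [X in _ * X]mxE Bp [X in _ + X]mxE subrr mulr0.
Qed.

Lemma N0_unique (N : 'M[R]_n) : N^T = N ->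
  (forall x : 'cV_n, Erows a (active a b y) *m (N *m x) = 0) ->
  (forall x : 'cV_n, Erows a (active a b y) *m x = 0 -> N *m x = x) ->
  N0 a b y = N.
Proof.
rewrite /N0 -tr_Ecols => NT N_im N_id.
set E := Ecols a _ in N_im N_id *; apply: gram_projector_unique => //.
by case: (mpinvP (E^T *m E)).
Qed.

(** The projector built from K has its range in the kernel of [Erows a K] and fixes that kernel. It
    coincides with the kernel for the full active set, so [N0_unique] applies. *)
Lemma N0_in_HS_Jacobian : feasible a b !=set0 -> HS_Jacobian a b y (N0 a b y).
Proof.
move=> C0; have [K HK Kker] := HS_index_active C0; exists K => //.
set E := Ecols a K; set F := Erows a K.
have FE : F^T = E by exact: tr_Erows.
have Gu : F *m E \in unitmx.
  rewrite /F -tr_Ecols; apply: gram_unit.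
  by rewrite /row_free mxrank_tr; apply/eqP; case: HK.
apply: N0_unique => [|x|x /Kker Fx].
- rewrite linearB /= trmx1 !trmx_mul trmx_inv trmx_mul FE.
  by rewrite -(trmxK F) FE mulmxA.
- apply/Kker; rewrite mulmxA mulmxBr mulmx1 !mulmxA mulmxV // mul1mx subrr.
  exact: mul0mx.
- by rewrite mulmxBl mul1mx -(mulmxA _ F x) [F *m x]Fx mulmx0 subr0.
Qed.

Local Notation K2 := (~: [set i | p i 0 == 0])%SET.
Let en : 'cV[R]_n := \col_i (if i \in K2 then 1 else 0).
Let an : 'cV[R]_n := \col_i (if i \in K2 then a i 0 else 0).

(* The equations on [al], [be], [ga] say that they are the entries of the
   inverse Gram matrix of [an] and [en]. When [a] is constant on [K2] this
   matrix is singular, but [a^T x = 0] then follows from [e^T x = 0]. *)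
Lemma N0_explicit (al be ga : R) :
  let q := \sum_(i in K2) a i 0 ^+ 2 in
  let s := \sum_(i in K2) a i 0 in
  let k : R := #|K2|%:R in
  al * s + be * k = 0 -> be * s + ga * k = 1 ->
  (dotv a p = b -> (al * q + be * s = 1 /\ be * q + ga * s = 0) \/
     exists t, forall i, i \in K2 -> a i 0 = t) ->
  (dotv a p <> b -> al = 0 /\ be = 0) ->
  N0 a b y = diag_mx en^T - al *: (an *m an^T)
    - be *: (an *m en^T + en *m an^T) - ga *: (en *m en^T).
Proof.
move=> q s k ask bsk abq ab0; set N := diag_mx _ - _ - _ - _.
have activeL i : (lshift 1 i \in active a b y) = (i \notin K2).
  by rewrite !inE Bmx_lshift cvec_lshift oppr_eq0 negbK.
have activeR i : (rshift n i \in active a b y) = (dotv a p == b).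
  by rewrite inE Bmx_rshift cvec_rshift.
have dot_en x : dotv en x = \sum_(i in K2) x i 0.
  rewrite dotvE [RHS]big_mkcond; apply: eq_bigr => i _; rewrite mxE.
  by case: ifP; rewrite ?mul1r ?mul0r.
have dot_an x : dotv an x = \sum_(i in K2) a i 0 * x i 0.
  rewrite dotvE [RHS]big_mkcond; apply: eq_bigr => i _; rewrite mxE.
  by case: ifP; rewrite ?mul0r.
have NE (x : 'cV_n) i : (N *m x) i 0 = if i \in K2 then x i 0
    - (al * dotv an x + be * dotv en x) * a i 0
    - (be * dotv an x + ga * dotv en x) else 0.
  have rank1 (u v : 'cV[R]_n) : u *m v^T *m x = dotv v x *: u.
    by rewrite -mulmxA [v^T *m x]mx11_scalar mul_mx_scalar.
  rewrite !mulmxBl -!scalemxAl mulmxDl !rank1 mul_diag_mx !mxE.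
  by case: ifP => _; ring.
have off_K2 (x v : 'cV[R]_n) : (forall i, i \notin K2 -> x i 0 = 0) ->
    dotv v x = \sum_(i in K2) v i 0 * x i 0.
  move=> x0; rewrite dotvE [RHS]big_mkcond; apply: eq_bigr => i _.
  by case: ifPn => // /x0->; rewrite mulr0.
have N0off (x : 'cV_n) i : i \notin K2 -> (N *m x) i 0 = 0.
  by move=> iK; rewrite NE (negPf iK).
have kE : \sum_(i in K2) (1 : R) = k by rewrite sumr_const.
have dot_eN x : dotv (ones R n) (N *m x) = 0.
  rewrite (off_K2 _ _ (N0off x)).
  set A := dotv an x; set S := dotv en x.
  (* The equations [ask] and [bsk] make the coefficient of A zero and cancel S. *)
  transitivity (S - (al * A + be * S) * s - (be * A + ga * S) * k).
    rewrite -kE /s [X in _ = X - _ - _]dot_en 2!mulr_sumr -!sumrB.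
    by apply: eq_bigr => i iK; rewrite mxE NE iK -/A -/S; ring.
  have : S * (be * s + ga * k) + A * (al * s + be * k) = S.
    by rewrite ask bsk; ring.
  by lra.
apply: N0_unique => [|x|x /Erows_eq0[Bx ex]].
- rewrite /N !linearB !linearZ linearD /= tr_diag_mx !trmx_mul !trmxK.
  by rewrite (addrC (en *m an^T)).
- apply/Erows_eq0; split=> // i; case: (split_ordP i) => j ->.
    by rewrite activeL Bmx_lshift => /(N0off x)->; rewrite oppr0.
  rewrite activeR Bmx_rshift => /eqP/abq; rewrite (off_K2 _ _ (N0off x)).
  case=> [[aq bq]|[t at_]]; last first.
    transitivity (t * dotv (ones R n) (N *m x)); last by rewrite dot_eN mulr0.
    rewrite (off_K2 _ _ (N0off x)) mulr_sumr.
    by apply: eq_bigr => j' /at_->; rewrite [ones R n j' 0]mxE mul1r.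
  set A := dotv an x; set S := dotv en x.
  transitivity (A - (al * A + be * S) * q - (be * A + ga * S) * s).
    rewrite /q /s [X in _ = X - _ - _]dot_an 2!mulr_sumr -!sumrB.
    by apply: eq_bigr => j' jK; rewrite NE jK -/A -/S; ring.
  have : A * (al * q + be * s) + S * (be * q + ga * s) = A.
    by rewrite aq bq; ring.
  by lra.
- have x0 i : i \notin K2 -> x i 0 = 0.
    by rewrite -activeL => /Bx/eqP; rewrite Bmx_lshift oppr_eq0 => /eqP.
  have S0 : dotv en x = 0.
    rewrite dot_en -[RHS]ex (off_K2 _ _ x0).
    by apply: eq_bigr => i _; rewrite mxE mul1r.
  apply/colP => i; rewrite NE; case: ifPn => [iK|/x0//].
  (* What remains are multiples of [dotv an x]: it vanishes if the row of [a] is active, and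
     otherwise its coefficients [al] and [be] do. *)
  rewrite S0; have [ap|/eqP/ab0[-> ->]] := eqVneq (dotv a p) b; last by ring.
  rewrite dot_an -(off_K2 _ _ x0).
  have -> : dotv a x = 0 by rewrite -(Bmx_rshift _ _ 0) Bx // activeR ap.
  by ring.
Qed.

(** The coordinates of the projection sum to 1, so they cannot all vanish. *)
Lemma card_K2_gt0 : feasible a b !=set0 -> 0 < #|K2|%:R :> R.
Proof.
move=> C0; have [[_ ep _] _] := eproj_feasible y C0; rewrite ltr0n card_gt0.
apply/eqP => /setP K20; move: ep; rewrite dotvE big1 => [/esym/eqP|i _].
  by rewrite oner_eq0.
by have := K20 i; rewrite !inE => /negbFE/eqP->; rewrite mulr0.
Qed.
End HS.

(** * Subvector sums and the case analysis on eta *)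

Lemma sum_subrows (R : realType) (n : nat) (K : {set 'I_n}) (u : 'cV[R]_n)
    (f : R -> R) :
  \sum_i f (subrows K u i 0) = \sum_(i in K) f (u i 0).
Proof. by rewrite [RHS]big_enum_val; apply: eq_bigr => i _; rewrite mxE. Qed.

Lemma enorm_subrows (R : realType) (n : nat) (K : {set 'I_n}) (u : 'cV[R]_n) :
  enorm (subrows K u) ^+ 2 = \sum_(i in K) u i 0 ^+ 2.
Proof.
rewrite sqr_sqrtr; first exact: (sum_subrows K u (fun t => t ^+ 2)).
by apply: sumr_ge0 => i _; exact: sqr_ge0.
Qed.

Lemma dotv_subrows_ones (R : realType) (n : nat) (K : {set 'I_n})
    (u : 'cV[R]_n) :
  dotv (subrows K u) (subrows K (ones R n)) = \sum_(i in K) u i 0.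
Proof.
rewrite dotvE -(sum_subrows K u id); apply: eq_bigr => i _.
by rewrite [X in _ * X]mxE [ones _ _ _ _]mxE mulr1.
Qed.

(** The equality case of Cauchy-Schwarz: the left-hand side is #|K| times the sum of squared
    deviations from the mean. *)
Lemma variance_eq0 (R : realFieldType) (I : finType) (K : {set I})
    (f : I -> R) :
  0 < #|K|%:R :> R ->
  (\sum_(i in K) f i ^+ 2) * #|K|%:R - (\sum_(i in K) f i) ^+ 2 = 0 ->
  forall i, i \in K -> f i = (\sum_(j in K) f j) / #|K|%:R.
Proof.
set q := \sum_(i in K) _; set s := \sum_(i in K) _; set k := #|K|%:R.
move=> k0 eta0 i iK.
have : \sum_(j in K) (f j - s / k) ^+ 2 == 0.
  have -> : \sum_(j in K) (f j - s / k) ^+ 2 =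
      q - s / k * 2 * s + (s / k) ^+ 2 * k.
    have kE : k = \sum_(j in K) 1 by rewrite sumr_const.
    rewrite [X in _ + _ * X]kE !mulr_sumr -sumrB -big_split /=.
    by apply: eq_bigr => j _; ring.
  have -> : q = s ^+ 2 / k.
    by apply: (mulIf (lt0r_neq0 k0)); rewrite divfK ?lt0r_neq0 //; lra.
  by apply/eqP; field; rewrite lt0r_neq0.
rewrite psumr_eq0 => [/allP/(_ i)|j _]; last exact: sqr_ge0.
by rewrite mem_index_enum iK sqrf_eq0 subr_eq0 => /(_ isT)/eqP.
Qed.

Theorem theorem5p3 (R : realType) (n : nat) (a : 'cV[R]_n) (b : R)
    (y : 'cV[R]_n) (hC : feasible a b !=set0) :
  let p := eproj (feasible a b) y in
  let K1 : {set 'I_n} := [set i | p i 0 == 0]%SET in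
  let K2 : {set 'I_n} := (~: K1)%SET in
  let k : R := #|K2|%:R in
  let w : 'cV[R]_n := \col_i (if i \in K2 then 1 else 0) in
  let en : 'cV[R]_n := \col_i (if i \in K2 then 1 else 0) in
  let an : 'cV[R]_n := \col_i (if i \in K2 then a i 0 else 0) in
  let aK := subrows K2 a in
  let eK := subrows K2 (ones R n) in
  let eta := enorm aK ^+ 2 * k - dotv aK eK ^+ 2 in
  let v := Num.sqrt k *: an - enorm aK *: en in
  let u := (Num.sg (dotv aK eK) * enorm aK) *: an + Num.sqrt k *: en in
  let eta1 := (enorm aK ^+ 2 + k) ^+ 2 in
  HS_Jacobian a b y (N0 a b y) /\
  (dotv a p <> b ->
     N0 a b y = diag_mx w^T - k^-1 *: (en *m en^T)) /\
  (dotv a p = b ->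
     (eta <> 0 ->
        N0 a b y = diag_mx w^T - eta^-1 *: (v *m v^T)
          - ((Num.sqrt k * enorm aK - dotv aK eK) / eta)
              *: (an *m en^T + en *m an^T)) /\
     (eta = 0 ->
        N0 a b y = diag_mx w^T - eta1^-1 *: (u *m u^T))).
Proof.
move=> p K1 K2 k w en an aK eK eta v u eta1.
have k0 : 0 < k by exact: card_K2_gt0.
have kN0 := lt0r_neq0 k0.
have qE : enorm aK ^+ 2 = \sum_(i in K2) a i 0 ^+ 2 by exact: enorm_subrows.
have sE : dotv aK eK = \sum_(i in K2) a i 0 by exact: dotv_subrows_ones.
have rk2 : Num.sqrt k ^+ 2 = k by rewrite sqr_sqrtr // ltW.
(* Covers case I, where the premise is vacuous, and the degenerate case, where [a] is constant on
   K2. *)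
have explicit0 : (dotv a p = b -> exists t, forall i, i \in K2 -> a i 0 = t) ->
    N0 a b y = diag_mx w^T - k^-1 *: (en *m en^T).
  move=> a_cst; rewrite (@N0_explicit _ _ a b y 0 0 k^-1) -/p -/K1 -/K2 -/k //.
  - by rewrite !scale0r !subr0.
  - by ring.
  - by rewrite mul0r add0r mulVf.
  - by move=> /a_cst; right.
split; first exact: N0_in_HS_Jacobian.
split=> [ap|ap]; first by apply: explicit0 => /ap.
split=> [/eqP eta0|eta0].
  (* These are the entries of the inverse of the Gram matrix of [an] and [en], whose determinant is
     [eta]. In the claimed formula the cross terms of v v^T cancel against part of the last
     summand. *)
  rewrite (@N0_explicit _ _ a b y (k / eta) (- dotv aK eK / eta)
    (enorm aK ^+ 2 / eta)) -/p -/K1 -/K2 -/k -?qE -?sE.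
  - apply/matrixP => i j.
    rewrite !mxE !big_ord1 !mxE -/K1 -/K2.
    rewrite -[in LHS]rk2.
    by case: ifP; case: ifP => _ _; field.
  - by field.
  - by rewrite /eta in eta0 *; field.
  - by move=> _; left; rewrite /eta in eta0 *; split; field.
  - by [].
have a_cst i : i \in K2 -> a i 0 = dotv aK eK / k.
  move=> iK; rewrite sE; apply: (@variance_eq0 _ _ K2 (fun i => a i 0)) => //.
  by rewrite -qE -sE.
rewrite explicit0; last by exists (dotv aK eK / k).
congr (_ - _).
have anE : an = (dotv aK eK / k) *: en.
  apply/colP => i; rewrite !mxE -/K1 -/K2; case: ifP => [/a_cst->|_].
    by rewrite mulr1.
  by rewrite mulr0.
have qs : enorm aK * Num.sqrt k = `|dotv aK eK|.
  apply/eqP; rewrite -(@eqrXn2 _ 2) ?mulr_ge0 ?sqrtr_ge0 //.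
  by rewrite exprMn rk2 real_normK ?num_real // -subr_eq0; apply/eqP.
(* By [anE] and [qs], [u] is a multiple of [en], and dividing u u^T by [eta1] leaves the factor 1 /
   k of [explicit0]. *)
have uE : u = ((enorm aK ^+ 2 + k) / Num.sqrt k) *: en.
  rewrite /u anE scalerA -scalerDl; congr (_ *: _).
  have rkN0 : Num.sqrt k != 0 by rewrite sqrtr_eq0 -ltNge.
  have -> : Num.sg (dotv aK eK) * enorm aK * (dotv aK eK / k) =
      enorm aK * `|dotv aK eK| / k by rewrite [in RHS]normrEsg; ring.
  by move: rkN0 rk2; rewrite -qs; move: (Num.sqrt k) => r r0 <-; field.
have q0 : 0 < enorm aK ^+ 2 + k by rewrite ltr_wpDl ?sqr_ge0.
rewrite uE linearZ /= -scalemxAl -scalemxAr !scalerA; congr (_ *: _).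
rewrite /eta1 -[in LHS]rk2; field.
by rewrite sqrtr_eq0 -ltNge k0 lt0r_neq0.
Qed.
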